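(* Let $n,m\ge 1$ and $A\in\mathbb{R}^{n\times n}$. For a symmetric matrix $R\in\mathbb{R}^{n\times n}$ consider the matrix Lyapunov equation $$A^\top Q+QA=-R \qquad (\ast)$$ with unknown symmetric $Q\in\mathbb{R}^{n\times n}$. (i) Let $C\in\mathbb{R}^{m\times n}$, assume that the pair $(A,C)$ is observable, and set $R=C^\top C$. If there exists a nonnegative definite (symmetric) matrix $Q$ satisfying $(\ast)$, then $A$ is stable. (ii) If $\int_0^\infty |e^{tA}x_0|^2\,dt<+\infty$ for all $x_0\in\mathbb{R}^n$, then for an arbitrary symmetric matrix $R\in\mathbb{R}^{n\times n}$, equation $(\ast)$ has exactly one symmetric solution $Q$. This solution is positive (respectively nonnegative) definite if $R$ is positive (respectively nonnegative) definite.
   Context: The matrix $A$ is called stable if $e^{tA}x_0\to 0$ as $t\to+\infty$ for all $x_0\in\mathbb{R}^n$. The pair $(A,C)$ is called observable if for every $x_0\in\mathbb{R}^n\setminus\{0\}$ there exists $\tau>0$ with $Ce^{\tau A}x_0\neq 0$. *)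

(* Defs.v *)
From HB Require Import structures.
From mathcomp Require Export all_boot all_order all_algebra.
From mathcomp Require Export all_classical all_reals all_analysis.

Set Implicit Arguments.
Unset Strict Implicit.
Unset Printing Implicit Defensive.

Import Order.TTheory GRing.Theory Num.Theory.
Import numFieldNormedType.Exports.

Local Open Scope classical_set_scope.
Local Open Scope ring_scope.

Definition expmx (K : realType) (n : nat) (A : 'M[K]_n) : 'M[K]_n :=
  limn (series (fun k : nat => (k`!%:R : K)^-1 *: A ^+ k)).

(* The library norm `|x| on 'cV[K]_n is the sup norm, hence this definition. *)
Definition enorm (K : realType) (n : nat) (x : 'cV[K]_n) : K :=
  Num.sqrt (\sum_(i < n) x i 0 ^+ 2).

Definition stable (K : realType) (n : nat) (A : 'M[K]_n) : Prop :=
  forall x0 : 'cV[K]_n, expmx (t *: A) *m x0 @[t --> +oo] --> (0 : 'cV[K]_n).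

Definition observable (K : realType) (n m : nat)
    (A : 'M[K]_n) (C : 'M[K]_(m, n)) : Prop :=
  forall x0 : 'cV[K]_n, x0 != 0 ->
    exists2 tau : K, 0 < tau & C *m expmx (tau *: A) *m x0 != 0.

Definition nonneg_definite (K : realType) (n : nat) (Q : 'M[K]_n) : Prop :=
  Q \is symmetricmx /\ forall x : 'cV[K]_n, 0 <= (x^T *m Q *m x) 0 0.

Definition pos_definite (K : realType) (n : nat) (Q : 'M[K]_n) : Prop :=
  Q \is symmetricmx /\
  forall x : 'cV[K]_n, x != 0 -> 0 < (x^T *m Q *m x) 0 0.

Definition lyapunov_eq (K : realType) (n : nat) (A R Q : 'M[K]_n) : Prop :=
  A^T *m Q + Q *m A = - R.

(* Main.v *)
(* For solutions x of x' = A x and Q solving the Lyapunov equation with right-hand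
   side - R, the derivative of x^T Q x is - x^T R x.

   (i) With R = C^T C the kernel of Q >= 0 is A-invariant and contained in that
   of C, so observability forces Q > 0.  Over one unit of time x^T Q x strictly
   decreases: otherwise C e^(tA) x vanishes on ]0, 1[, hence so do all its
   derivatives, hence C A^k y = 0 for all k with y = e^(A/2) x.  Positive definite
   forms on a finite-dimensional space being comparable, one unit of time is a
   contraction for the form Q, whence x(t) -> 0.

   (ii) Square integrability provides times at which two given trajectories are
   simultaneously arbitrarily small.  When R = 0, x^T Q y is constant along
   trajectories, so Q = 0: the Lyapunov operator is injective, hence bijective on
   matrices.  When R >= 0, x^T Q x is nonincreasing along trajectories and gets
   arbitrarily small, so Q >= 0; and x^T Q x = 0 then forces Q x = 0, thus
   x^T R x = 0. *)
Require Import Defs.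
From mathcomp Require Import all_boot all_order all_algebra.
From mathcomp Require Import all_classical all_reals all_analysis.
From mathcomp Require Import measurable_realfun ring lra.

Set Implicit Arguments.
Unset Strict Implicit.
Unset Printing Implicit Defensive.

Import Order.TTheory GRing.Theory Num.Theory.
Import numFieldNormedType.Exports.

Local Open Scope classical_set_scope.
Local Open Scope ring_scope.

(** * Entrywise limits of matrices *)

Section MatrixLimits.
Context {K : realType} {T : Type} {F : set_system T}.

(** A neighbourhood of a matrix contains a product of neighbourhoods of its entries, and a filter is
    stable under the finite intersection over all entries. *)
Lemma cvg_mx m n (FF : Filter F) (f : T -> 'M[K]_(m, n)) (L : 'M[K]_(m, n)) :
  (forall i j, f x i j @[x --> F] --> L i j) -> f x @[x --> F] --> L.
Proof.
move=> fL A [P PL PA].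
have : F [set x | forall i j, P i j (f x i j)].
  apply: (@filter_forall _ _ (fun i => [set x | forall j, P i j (f x i j)])).
  move=> i; apply: (@filter_forall _ _ (fun j => [set x | P i j (f x i j)])).
  by move=> j; exact: fL.
by move=> FP; apply: (@filterS _ F _ _ _ _ FP) => x Px; exact: PA.
Qed.

Lemma cvg_mulmx m n p (FF : Filter F) (f : T -> 'M[K]_(m, n))
    (g : T -> 'M[K]_(n, p)) (L : 'M[K]_(m, n)) (M : 'M[K]_(n, p)) :
  f x @[x --> F] --> L -> g x @[x --> F] --> M ->
  f x *m g x @[x --> F] --> L *m M.
Proof.
move=> fL gM; apply: cvg_mx => i j; rewrite mxE.
under eq_cvg do rewrite mxE.
apply: cvg_big => [|l _]; first exact: add_continuous.
apply: cvgM; first exact: (cvg_comp _ _ fL (@coord_continuous _ _ _ i l L)).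
exact: (cvg_comp _ _ gM (@coord_continuous _ _ _ l j M)).
Qed.

End MatrixLimits.

(** * The matrix exponential as a family of scalar power series *)

Section MatrixExponential.
Context {K : realType} {n : nat}.
Implicit Type A B : 'M[K]_n.

Lemma expmx_coef_bound A : exists2 r : K, 0 <= r &
  forall k i j, `|(A ^+ k) i j| <= r ^+ k.
Proof.
exists (\sum_i \sum_j `|A i j|) => [|k].
  by apply: sumr_ge0 => i _; apply: sumr_ge0.
elim: k => [|k IH] i j.
  by rewrite !expr0 mxE; case: (i == j); rewrite ?normr1 ?normr0.
rewrite !exprS mxE (le_trans (ler_norm_sum _ _ _))// mulr_suml.
apply: (@le_trans _ _ ((\sum_l `|A i l|) * (\sum_i \sum_j `|A i j|) ^+ k)).
  by rewrite mulr_suml ler_sum// => l _; rewrite normrM ler_wpM2l.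
rewrite [leRHS](bigD1 i)//= lerDl sumr_ge0// => l _.
by rewrite mulr_ge0 ?sumr_ge0//; exact: le_trans (IH i j).
Qed.

(** Comparison with [M] times the exponential series at [r * |x|]. The factor [M] accommodates
    coefficients shifted by [d], for which it is [r ^+ d]. *)
Lemma is_cvg_pseries_fact (a : K^nat) (M r x : K) : 0 <= r ->
  (forall k, `|a k| <= M * r ^+ k) -> cvgn (pseries (fun k => a k / k`!%:R) x).
Proof.
move=> r0 aM; apply: normed_cvg.
apply: (@series_le_cvg _ _ (M *: exp_coeff (r * `|x|))) => [k|k|k|].
- by rewrite normr_ge0.
- have := le_trans (normr_ge0 _) (aM k).
  rewrite !fctE /exp_coeff /= exprMn => Mr.
  by rewrite /GRing.scale/= !mulrA mulr_ge0 ?invr_ge0// mulr_ge0 ?exprn_ge0.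
- rewrite /= !normrM normrX /exp_coeff !fctE /GRing.scale/= exprMn.
  rewrite normfV normr_nat [leLHS]mulrAC !mulrA !ler_wpM2r ?invr_ge0 ?exprn_ge0//.
- by apply: is_cvg_seriesZ; exact: is_cvg_series_exp_coeff.
Qed.

Lemma mxexprZ (t : K) A k : (t *: A) ^+ k = t ^+ k *: A ^+ k.
Proof.
elim: k => [|k IH]; first by rewrite !expr0 scale1r.
by rewrite !exprS IH -!mulmxE -scalemxAl -scalemxAr scalerA.
Qed.

Lemma expmx_seriesE A (t : K) i j :
  (fun N => series (fun k => (k`!%:R : K)^-1 *: (t *: A) ^+ k) N i j) =
  pseries (fun k => (A ^+ k) i j / k`!%:R) t.
Proof.
apply/funext => N; rewrite /pseries /series /= summxE.
by apply: eq_bigr => k _; rewrite mxexprZ !mxE; ring.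
Qed.

(** [limn] is meaningful only for convergent sequences, so this is what makes [expmx] the actual
    sum. Each entry is a scalar power series taken at 1. *)
Lemma expmx_cvg A :
  series (fun k => (k`!%:R : K)^-1 *: A ^+ k) @ \oo --> expmx A.
Proof.
have [r r0 Ar] := expmx_coef_bound A.
set s := series _.
suff : s @ \oo --> \matrix_(i, j) limn (fun N => s N i j).
  by move=> sl; apply: cvgP sl.
apply: cvg_mx => i j; rewrite mxE.
rewrite /s -[A]scale1r expmx_seriesE.
by apply: (@is_cvg_pseries_fact _ 1 r) => // k; rewrite mul1r.
Qed.

Lemma expmxE A (t : K) i j :
  expmx (t *: A) i j = limn (pseries (fun k => (A ^+ k) i j / k`!%:R) t).
Proof.
rewrite -expmx_seriesE; apply/esym/cvg_lim => //.
exact: (cvg_comp _ _ (@expmx_cvg (t *: A)) (@coord_continuous _ _ _ i j _)).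
Qed.

(** The outer factors serve three purposes: commutation of A with its exponential, differentiation
    of the exponential, and expansion of the output C e^(tA) x. *)
Lemma expmx_cvg_entry m p A (B : 'M[K]_(m, n)) (C : 'M[K]_(n, p)) (t : K) i j :
  pseries (fun k => (B *m A ^+ k *m C) i j / k`!%:R) t @ \oo -->
    (B *m expmx (t *: A) *m C) i j.
Proof.
have BEC : B *m series (fun k => (k`!%:R : K)^-1 *: (t *: A) ^+ k) N *m C
    @[N --> \oo] --> B *m expmx (t *: A) *m C.
  apply: cvg_mulmx; last exact: cvg_cst.
  by apply: cvg_mulmx; [exact: cvg_cst|exact: expmx_cvg].
have := cvg_comp _ _ BEC (@coord_continuous _ _ _ i j _).
rewrite [X in X @ _ --> _](_ : _ =
  pseries (fun k => (B *m A ^+ k *m C) i j / k`!%:R) t)//.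
apply/funext => N /=; rewrite /pseries /series /= mulmx_sumr mulmx_suml summxE.
apply: eq_bigr => k _; rewrite mxexprZ scalerA -scalemxAr -scalemxAl [LHS]mxE.
by ring.
Qed.

Lemma expmx0 : expmx (0 : 'M[K]_n) = 1%:M.
Proof.
apply: cvg_lim => //; suff : \forall N \near \oo,
    series (fun k => (k`!%:R : K)^-1 *: (0 : 'M[K]_n) ^+ k) N = 1%:M.
  exact: cvg_near_cst.
near=> N.
(* The partial sum runs over k < N and is empty for N = 0; afterwards only the term k = 0
   survives. *)
have N0 : (0 < N)%N by near: N; exact: nbhs_infty_gt.
rewrite /series/= -(prednK N0) big_nat_recl//= expr0 invr1 scale1r big1 ?addr0//.
by move=> k _; rewrite exprS -mulmxE mul0mx scaler0.
Unshelve. all: by end_near. Qed.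

End MatrixExponential.

(** * Entrywise derivatives of matrix-valued functions *)

Definition is_mxderive (K : realType) (m n : nat) (F : K -> 'M[K]_(m, n))
    (t : K) (D : 'M[K]_(m, n)) : Prop :=
  forall i j, is_derive t (1 : K) (fun s => F s i j) (D i j).

Section MatrixDerivative.
Context {K : realType}.

Lemma is_mxderive_cst m n (B : 'M[K]_(m, n)) t : is_mxderive (fun=> B) t 0.
Proof. by move=> i j; rewrite mxE; exact: is_derive_cst. Qed.

Lemma is_mxderive_tr m n (F : K -> 'M[K]_(m, n)) t D :
  is_mxderive F t D -> is_mxderive (fun s => (F s)^T) t D^T.
Proof.
move=> FD i j; rewrite mxE.
under eq_fun do rewrite mxE.
exact: FD.
Qed.

Lemma is_mxderive_mulmx m n p (F : K -> 'M[K]_(m, n)) (G : K -> 'M[K]_(n, p))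
    t D E : is_mxderive F t D -> is_mxderive G t E ->
  is_mxderive (fun s => F s *m G s) t (D *m G t + F t *m E).
Proof.
move=> FD GE i j.
have -> : (fun s => (F s *m G s) i j) = \sum_l (fun s => F s i l * G s l j).
  by apply/funext => s; rewrite mxE fct_sumE.
rewrite !mxE -big_split/=; apply: is_derive_sum => l.
apply: (is_derive_eq (is_deriveM (FD i l) (GE l j))).
by rewrite /GRing.scale/=; ring.
Qed.

Lemma is_mxderive_subl m n (F : K -> 'M[K]_(m, n)) (u t : K) D :
  is_mxderive F (u - t) D -> is_mxderive (fun s => F (u - s)) t (- D).
Proof.
move=> FD i j; rewrite mxE -mulrN1.
apply: (is_derive1_comp (f := fun s => F s i j) (g := fun s => u - s)).
  exact: FD.
by apply: (is_derive_eq (is_deriveB (is_derive_cst u t 1) (is_derive_id t 1)));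
  rewrite sub0r.
Qed.

Lemma is_mxderive0_cst m n (F : K -> 'M[K]_(m, n)) :
  (forall t, is_mxderive F t 0) -> forall s t, F s = F t.
Proof.
move=> F0 s t; apply/matrixP => i j.
apply: (is_derive_0_is_cst (f := fun s => F s i j)) => x.
by have := F0 x i j; rewrite mxE.
Qed.

End MatrixDerivative.

(** * The flow e^(tA): derivative, group law, bilinear forms along trajectories *)

Section Flow.
Context {K : realType} {n : nat}.
Implicit Types A Q : 'M[K]_n.

Lemma expmx_comm A t : A *m expmx (t *: A) = expmx (t *: A) *m A.
Proof.
apply/matrixP => i j.
have := @expmx_cvg_entry K n n n A A 1%:M t i j.
have := @expmx_cvg_entry K n n n A 1%:M A t i j.
rewrite mulmx1 mul1mx => /(cvg_lim _) <-// /(cvg_lim _) <-//.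
congr (limn (pseries _ t)); apply/funext => k.
by rewrite mul1mx mulmx1 !mulmxE -exprSr exprS.
Qed.

Lemma is_mxderive_expmx A t :
  is_mxderive (fun s => expmx (s *: A)) t (A *m expmx (t *: A)).
Proof.
move=> i j; have [r r0 Ar] := expmx_coef_bound A.
pose c k := (A ^+ k) i j / k`!%:R : K.
(* Formal differentiation of a series with coefficients a_k / k! merely shifts a, so one convergence
   bound covers the series and all its derivatives. *)
have dc d : pseries_diffs (fun k => (A ^+ (k + d)) i j / k`!%:R : K) =
    (fun k => (A ^+ (k + d.+1)) i j / k`!%:R).
  apply/funext => k; rewrite /pseries_diffs factS natrM addSnnS.
  by rewrite invfM mulrCA mulVKf ?pnatr_eq0.
have cvc d x : cvgn (pseries (fun k => (A ^+ (k + d)) i j / k`!%:R : K) x).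
  by apply: (@is_cvg_pseries_fact _ _ (r ^+ d) r) => // k; rewrite -exprD addnC.
have c0 : c = (fun k => (A ^+ (k + 0)) i j / k`!%:R).
  by apply/funext => k; rewrite addn0.
have -> : (fun s => expmx (s *: A) i j) = (fun s => limn (pseries c s)).
  by apply/funext => s; rewrite expmxE.
have -> : (A *m expmx (t *: A)) i j = limn (pseries (pseries_diffs c) t).
  apply/esym/cvg_lim => //; rewrite c0 dc.
  have := @expmx_cvg_entry K n n n A A 1%:M t i j; rewrite mulmx1.
  by under [X in pseries X]eq_fun do rewrite mulmx1 mulmxE -exprS -addn1.
(* Termwise differentiation at t requires convergence at some point of larger absolute value; |t| +
   1 is one. *)
apply: (@pseries_snd_diffs _ _ (`|t| + 1)).
all: rewrite ?c0 ?dc//.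
by rewrite [ltRHS]ger0_norm ?ltrDl ?addr_ge0.
Qed.

(** The product e^((s+t-x)A) e^(xA) has zero derivative in x, because A commutes with its
    exponentials; compare x = 0 with x = t. *)
Lemma expmxD A (s t : K) :
  expmx ((s + t) *: A) = expmx (s *: A) *m expmx (t *: A).
Proof.
pose G x := expmx ((s + t - x) *: A) *m expmx (x *: A).
have G0 x : is_mxderive G x 0.
  have := is_mxderive_mulmx (is_mxderive_subl (is_mxderive_expmx A (s + t - x)))
    (is_mxderive_expmx A x).
  by rewrite expmx_comm mulNmx mulmxA addNr.
by have := is_mxderive0_cst G0 0 t; rewrite /G subr0 scale0r expmx0 mulmx1 addrK.
Qed.

Lemma expmxN_mul A t : expmx (- t *: A) *m expmx (t *: A) = 1%:M.
Proof. by rewrite -expmxD addNr scale0r expmx0. Qed.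

(** Two trajectories are allowed because a matrix not known to be symmetric is determined by its
    bilinear form, not by its quadratic form. *)
Lemma is_mxderive_form A Q (x y : 'cV[K]_n) t :
  is_mxderive (fun s => (expmx (s *: A) *m x)^T *m Q *m (expmx (s *: A) *m y)) t
    ((expmx (t *: A) *m x)^T *m (A^T *m Q + Q *m A) *m (expmx (t *: A) *m y)).
Proof.
have dE (z : 'cV[K]_n) : is_mxderive (fun s => expmx (s *: A) *m z) t
      (A *m (expmx (t *: A) *m z)).
  have := is_mxderive_mulmx (is_mxderive_expmx A t) (is_mxderive_cst z t).
  by rewrite mulmx0 addr0 mulmxA.
have := is_mxderive_mulmx (is_mxderive_mulmx (is_mxderive_tr (dE x))
  (is_mxderive_cst Q t)) (dE y).
by rewrite mulmx0 addr0 [(A *m _)^T]trmx_mul mulmxDr mulmxDl !mulmxA.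
Qed.

End Flow.

(** * Quadratic forms: Cauchy-Schwarz, coercivity and comparison *)

Section QuadraticForms.
Context {K : realFieldType}.

Lemma symmetricmxE n (Q : 'M[K]_n) : (Q \is symmetricmx) = (Q == Q^T).
Proof. by rewrite is_hermitianmxE expr0 scale1r map_mx_id. Qed.

Lemma sqnorm_ge0 n (x : 'cV[K]_n) : 0 <= (x^T *m x) 0 0.
Proof. by rewrite mxE sumr_ge0// => i _; rewrite mxE -expr2 sqr_ge0. Qed.

Lemma sqr_coord_le n (x : 'cV[K]_n) i : x i 0 ^+ 2 <= (x^T *m x) 0 0.
Proof.
rewrite mxE (bigD1 i)//= mxE -expr2 lerDl sumr_ge0// => j _.
by rewrite mxE -expr2 sqr_ge0.
Qed.

Lemma sqnorm_eq0 n (x : 'cV[K]_n) : (x^T *m x) 0 0 = 0 -> x = 0.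
Proof.
move=> x0; apply/matrixP => i j; rewrite ord1 mxE.
by apply/eqP; rewrite -sqrf_eq0 eq_le sqr_ge0 andbT -x0 sqr_coord_le.
Qed.

Lemma mx_eq0_form m n (Q : 'M[K]_(m, n)) :
  (forall (x : 'cV_m) (y : 'cV_n), (x^T *m Q *m y) 0 0 = 0) -> Q = 0.
Proof.
move=> Q0; apply/matrixP => i j; rewrite mxE.
rewrite -[RHS](Q0 (delta_mx i 0 : 'cV_m) (delta_mx j 0 : 'cV_n)).
by rewrite trmx_delta -rowE -colE !mxE.
Qed.

Lemma form_sym n (Q : 'M[K]_n) (x y : 'cV_n) : Q \is symmetricmx ->
  (x^T *m Q *m y) 0 0 = (y^T *m Q *m x) 0 0.
Proof.
rewrite symmetricmxE => /eqP Qs.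
have -> : y^T *m Q *m x = (x^T *m Q *m y)^T.
  by rewrite 2!trmx_mul trmxK -Qs mulmxA.
by rewrite [RHS]mxE.
Qed.

Lemma form_comb n (Q : 'M[K]_n) (x y : 'cV_n) (r s : K) : Q \is symmetricmx ->
  ((r *: x + s *: y)^T *m Q *m (r *: x + s *: y)) 0 0 =
    r ^+ 2 * (x^T *m Q *m x) 0 0 + 2 * r * s * (x^T *m Q *m y) 0 0 +
    s ^+ 2 * (y^T *m Q *m y) 0 0.
Proof.
move=> Qs; have := form_sym x y Qs; rewrite [(_ + _)^T]linearD/= ![(_ *: _)^T]linearZ/=.
rewrite !mulmxDl !mulmxDr -!scalemxAl -!scalemxAr.
set a := x^T *m Q *m x; set b := x^T *m Q *m y; set c := y^T *m Q *m x.
by set d := y^T *m Q *m y; rewrite !mxE => ->; ring.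
Qed.

Lemma form_cauchy_schwarz n (Q : 'M[K]_n) (x y : 'cV_n) : Q \is symmetricmx ->
  (forall x : 'cV_n, 0 <= (x^T *m Q *m x) 0 0) ->
  (x^T *m Q *m y) 0 0 ^+ 2 <= (x^T *m Q *m x) 0 0 * (y^T *m Q *m y) 0 0.
Proof.
move=> Qs Q0.
have Qrs r s : 0 <= r ^+ 2 * (x^T *m Q *m x) 0 0 +
    2 * r * s * (x^T *m Q *m y) 0 0 + s ^+ 2 * (y^T *m Q *m y) 0 0.
  by rewrite -form_comb.
move: Qrs (Q0 x) (Q0 y); set a := (x^T *m Q *m x) 0 0.
set b := (x^T *m Q *m y) 0 0; set c := (y^T *m Q *m y) 0 0 => Qrs a0 c0.
have [c_gt0|] := ltrP 0 c.
  (* The form at c x - b y equals c (a c - b^2). *)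
  have := Qrs c (- b).
  rewrite (_ : _ + _ = c * (a * c - b ^+ 2)); last by ring.
  by rewrite pmulr_rge0// subr_ge0.
move=> c_le0; have {c_le0}c0' : c = 0 by apply/eqP; rewrite eq_le c_le0.
(* When c = 0 the form at - b x + (a + 1) y equals - b^2 (a + 2), so b = 0. *)
have := Qrs (- b) (a + 1); rewrite c0' => Qb.
nra.
Qed.

(** Cauchy-Schwarz for x and y = Q x: the mixed term y^T Q x is |Q x|^2, and its square is bounded
    by 0. *)
Lemma nonneg_form_eq0 n (Q : 'M[K]_n) (x : 'cV_n) : Q \is symmetricmx ->
  (forall x : 'cV_n, 0 <= (x^T *m Q *m x) 0 0) ->
  (x^T *m Q *m x) 0 0 = 0 -> Q *m x = 0.
Proof.
move=> Qs Q0 x0; apply: sqnorm_eq0; set y := Q *m x.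
have := form_cauchy_schwarz y x Qs Q0; rewrite x0 mulr0 -mulmxA -/y => y0.
by apply/eqP; rewrite -sqrf_eq0 eq_le y0 sqr_ge0.
Qed.

Lemma form_bound n (Q : 'M[K]_n) : exists2 M : K, 0 <= M & forall x y : 'cV_n,
  `|(x^T *m Q *m y) 0 0| <= M * ((x^T *m x) 0 0 + (y^T *m y) 0 0).
Proof.
exists (\sum_i \sum_j `|Q i j|) => [|x y].
  by apply: sumr_ge0 => i _; apply: sumr_ge0.
rewrite exchange_big/= mxE mulr_suml.
rewrite (le_trans (ler_norm_sum _ _ _))// ler_sum// => j _.
rewrite mxE normrM !mulr_suml (le_trans (ler_wpM2r _ (ler_norm_sum _ _ _)))//.
rewrite mulr_suml ler_sum// => i _; rewrite mxE normrM mulrAC mulrC ler_wpM2l//.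
have := lerD (sqr_coord_le x i) (sqr_coord_le y j).
have : 0 <= (`|x i 0| - `|y j 0|) ^+ 2 by exact: sqr_ge0.
have : 0 <= `|x i 0| * `|y j 0| by rewrite mulr_ge0.
rewrite -(real_normK (num_real (x i 0))) -(real_normK (num_real (y j 0))).
nra.
Qed.

(** An algebraic substitute for compactness of the sphere: with z_i = P^-1 e_i one has x_i = x^T P
    z_i, so Cauchy-Schwarz bounds x_i^2 by (x^T P x)(z_i^T P z_i). Summing over i gives the
    constant. *)
Lemma pos_form_coercive n (P : 'M[K]_n) : P \is symmetricmx ->
  (forall x : 'cV_n, x != 0 -> 0 < (x^T *m P *m x) 0 0) ->
  exists2 c : K, 0 <= c & forall x : 'cV_n,
    (x^T *m x) 0 0 <= c * (x^T *m P *m x) 0 0.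
Proof.
move=> Ps P0.
have P_ge0 (x : 'cV_n) : 0 <= (x^T *m P *m x) 0 0.
  have [->|/P0/ltW//] := eqVneq x 0; by rewrite mulmx0 mxE.
have Pu : P \in unitmx.
  rewrite -row_free_unit; apply: inj_row_free => v vP; apply: contra_eq vP => v0.
  apply: contraTneq (P0 v^T _) => [vP|]; last first.
    by apply: contra v0 => /eqP/(congr1 trmx); rewrite trmxK trmx0 => ->.
  by rewrite trmxK vP mul0mx mxE ltxx.
pose z i : 'cV_n := invmx P *m delta_mx i 0.
exists (\sum_i ((z i)^T *m P *m z i) 0 0) => [|x]; first exact: sumr_ge0.
rewrite mxE mulr_suml ler_sum// => i _; rewrite mxE -expr2 mulrC.
apply: le_trans (form_cauchy_schwarz x (z i) Ps P_ge0).
by rewrite /z mulmxA mulmxK// -colE !mxE.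
Qed.

Lemma pos_form_dominates n (P Q : 'M[K]_n) : P \is symmetricmx ->
  (forall x : 'cV_n, x != 0 -> 0 < (x^T *m P *m x) 0 0) ->
  exists2 d : K, 1 <= d & forall x : 'cV_n,
    (x^T *m Q *m x) 0 0 <= d * (x^T *m P *m x) 0 0.
Proof.
move=> Ps P0; have [c c0 Pc] := pos_form_coercive Ps P0.
(* [c + c] arises because [form_bound] at y = x counts |x|^2 twice; the summand 1 ensures d >= 1. *)
have [M M0 QM] := form_bound Q; exists (1 + M * (c + c)) => [|x].
  by rewrite lerDl mulr_ge0// addr_ge0.
apply: le_trans (ler_norm _) (le_trans (QM x x) _).
have Px := Pc x; have x0 := sqnorm_ge0 x.
have P_ge0 : 0 <= (x^T *m P *m x) 0 0.
  by have [->|/P0/ltW//] := eqVneq x 0; rewrite mulmx0 mxE.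
by rewrite mulrDl mul1r -mulrA ler_wpDl// ler_wpM2l// mulrDl lerD.
Qed.

End QuadraticForms.

(** * Lyapunov functions along trajectories and observability *)

Section Lyapunov.
Context {K : realType} {n : nat}.
Implicit Types (A Q R : 'M[K]_n) (x y : 'cV[K]_n).

Lemma is_mxderive_locally_cst m p (F : K -> 'M[K]_(m, p)) (a b t : K) B D :
  (forall s, s \in `]a, b[ -> F s = B) -> t \in `]a, b[ ->
  is_mxderive F t D -> D = 0.
Proof.
move=> FB tab FD; apply/matrixP => i j; rewrite mxE.
have Fnear : \forall s \near t, (fun=> B i j) s = F s i j.
  have : \forall s \near t, s \in `]a, b[ by exact: near_in_itvoo.
  by apply: filterS => s /FB ->.
rewrite -[LHS](@derive_val _ _ _ _ _ _ _ (FD i j)) -(near_eq_derive (1 : K) Fnear).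
exact: derive_val.
Qed.

Lemma lyapunov_derive A R Q x (t : K) : lyapunov_eq A R Q ->
  is_derive t (1 : K)
    (fun s => ((expmx (s *: A) *m x)^T *m Q *m (expmx (s *: A) *m x)) 0 0)
    (- ((expmx (t *: A) *m x)^T *m R *m (expmx (t *: A) *m x)) 0 0).
Proof.
move=> AQ; have := @is_mxderive_form K n A Q x x t 0 0.
by rewrite AQ mulmxN mulNmx [in X in is_derive _ _ _ X -> _]mxE.
Qed.

Lemma lyapunov_nincr A R Q x (s t : K) : lyapunov_eq A R Q ->
  (forall x, 0 <= (x^T *m R *m x) 0 0) -> s <= t ->
  ((expmx (t *: A) *m x)^T *m Q *m (expmx (t *: A) *m x)) 0 0 <=
  ((expmx (s *: A) *m x)^T *m Q *m (expmx (s *: A) *m x)) 0 0.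
Proof.
move=> AQ R0 st.
pose V s := ((expmx (s *: A) *m x)^T *m Q *m (expmx (s *: A) *m x)) 0 0.
have dV u := @lyapunov_derive A R Q x u AQ.
rewrite -/(V s) -/(V t).
apply: (@ler0_derive1_nincry _ V s) => // [u _|].
- by rewrite derive1E (@derive_val _ _ _ _ _ _ _ (dV u)) oppr_le0.
- by apply: derivable_within_continuous => u _; have := dV u; case.
Qed.

Lemma expmx_output_eq0 m A (C : 'M[K]_(m, n)) x t :
  (forall k, C *m A ^+ k *m x = 0) -> C *m expmx (t *: A) *m x = 0.
Proof.
move=> CAx; apply/matrixP => i j; rewrite [RHS]mxE.
have /(cvg_lim _) <-// := @expmx_cvg_entry K n _ _ A C x t i j.
rewrite (_ : pseries _ t = fun=> 0) ?lim_cst//.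
apply/funext => N; rewrite /pseries /series /= big1// => k _.
by rewrite CAx mxE !mul0r.
Qed.

(** The C A^k x are, up to factorials, the Taylor coefficients of the output C e^(tA) x; if all
    vanish, so does the output at every time. *)
Lemma observable_markov_eq0 m A (C : 'M[K]_(m, n)) x : observable A C ->
  (forall k, C *m A ^+ k *m x = 0) -> x = 0.
Proof.
move=> obs CAx; apply/eqP/negP => /negP/obs[t _ /eqP]; apply.
exact: expmx_output_eq0.
Qed.

Lemma gram_form m (C : 'M[K]_(m, n)) x :
  x^T *m (C^T *m C) *m x = (C *m x)^T *m (C *m x).
Proof. by rewrite trmx_mul !mulmxA. Qed.

Lemma gram_form_ge0 m (C : 'M[K]_(m, n)) x :
  0 <= (x^T *m (C^T *m C) *m x) 0 0.
Proof. by rewrite gram_form sqnorm_ge0. Qed.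

Lemma observable_pos_definite m A (C : 'M[K]_(m, n)) Q : observable A C ->
  nonneg_definite Q -> lyapunov_eq A (C^T *m C) Q -> pos_definite Q.
Proof.
move=> obs [Qs Q0] AQ; split=> // x x0; rewrite lt_neqAle Q0 andbT eq_sym.
apply: contra x0 => /eqP xQx.
(* For Q y = 0, the equation between y^T and y gives |C y|^2 = 0; applied to y alone, it then leaves
   Q A y = 0. *)
have kerQ y : Q *m y = 0 -> C *m y = 0 /\ Q *m (A *m y) = 0.
  move=> Qy; have QyT : y^T *m Q = 0.
    move: Qs; rewrite symmetricmxE => /eqP ->.
    by rewrite -trmx_mul Qy trmx0.
  have Cy : C *m y = 0.
    apply: sqnorm_eq0; rewrite -gram_form -[C^T *m C]opprK -AQ.
    rewrite mulmxN mulNmx mulmxDr mulmxDl !mulmxA QyT !mul0mx -!mulmxA Qy.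
    by rewrite !mulmx0 addr0 oppr0 mxE.
  split=> //; have := congr1 (mulmx^~ y) AQ.
  by rewrite /= mulmxDl -!mulmxA Qy mulmx0 add0r mulNmx -mulmxA Cy mulmx0 oppr0.
have QAx k : Q *m (A ^+ k *m x) = 0.
  elim: k => [|k /kerQ[_]]; first by rewrite expr0 mul1mx nonneg_form_eq0.
  by rewrite exprS -mulmxE !mulmxA.
apply/eqP/(observable_markov_eq0 obs) => k.
by rewrite -mulmxA; have [] := kerQ _ (QAx k).
Qed.

Lemma observable_decrease m A (C : 'M[K]_(m, n)) Q x : observable A C ->
  lyapunov_eq A (C^T *m C) Q -> x != 0 ->
  ((expmx A *m x)^T *m Q *m (expmx A *m x)) 0 0 < (x^T *m Q *m x) 0 0.
Proof.
move=> obs AQ x0.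
pose V s := (expmx (s *: A) *m x)^T *m Q *m (expmx (s *: A) *m x).
have Vle s t := @lyapunov_nincr A _ Q x s t AQ (@gram_form_ge0 _ C).
have V0 : V 0 = x^T *m Q *m x by rewrite /V scale0r expmx0 mul1mx.
have V1 : V 1 = (expmx A *m x)^T *m Q *m (expmx A *m x) by rewrite /V scale1r.
rewrite -V0 -V1 lt_neqAle Vle ?ler01// andbT.
apply: contra x0 => /eqP V10.
(* Induction on k. For k = 0, V is squeezed between its equal values at 1 and 0, so its derivative -
   |C e^(tA) x|^2 vanishes on ]0, 1[. The next k comes from differentiating the identity for k. *)
have C0 k : forall t, t \in `]0, 1[ -> C *m A ^+ k *m (expmx (t *: A) *m x) = 0.
  elim: k => [t t01|k IH t t01].
    have Vcst s : s \in `]0, 1[ -> V s = V 0.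
      rewrite in_itv/= => /andP[s0 s1]; apply/matrixP => i j; rewrite !ord1.
      by apply: le_anti; rewrite {1}/V Vle ?(ltW s0)//= -V10 Vle// ltW.
    have := is_mxderive_locally_cst Vcst t01 (@is_mxderive_form _ _ A Q x x t).
    rewrite AQ mulmxN mulNmx gram_form => /(congr1 (fun M : 'M[K]_1 => M 0 0)).
    rewrite mxE [RHS]mxE => /eqP; rewrite oppr_eq0 => /eqP/sqnorm_eq0.
    by rewrite expr0 mulmx1.
  have dE := is_mxderive_mulmx (is_mxderive_expmx A t) (is_mxderive_cst x t).
  have := is_mxderive_mulmx (is_mxderive_cst (C *m A ^+ k) t) dE.
  move=> /(is_mxderive_locally_cst IH t01).
  by rewrite mul0mx add0r mulmx0 addr0 exprSr -mulmxE !mulmxA.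
have h01 : (2^-1 : K) \in `]0, 1[.
  by rewrite in_itv/= invr_gt0 invf_lt1 ?ltr1n ?ltr0n.
have /(observable_markov_eq0 obs) y0 k := C0 k _ h01.
(* Undo the flow: x = e^(-A/2) y with y = 0. *)
by rewrite -[x]mul1mx -(expmxN_mul A 2^-1) -mulmxA y0 mulmx0.
Qed.

End Lyapunov.

(** * Stability from observability *)

Section Stability.
Context {K : realType} {n : nat}.
Implicit Types (A Q R : 'M[K]_n) (x y : 'cV[K]_n).

Lemma observable_stable m A (C : 'M[K]_(m, n)) Q : observable A C ->
  nonneg_definite Q -> lyapunov_eq A (C^T *m C) Q -> stable A.
Proof.
move=> obs Qn AQ; have [Qs Qpos] := observable_pos_definite obs Qn AQ.
have [_ Q_ge0] := Qn.
(* W is the loss of the form Q over one unit of time. It is positive definite, so Q <= d W, which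
   makes the unit-time flow contract Q by q = 1 - 1/d. *)
pose W := Q - (expmx A)^T *m Q *m expmx A.
have WE x : (x^T *m W *m x) 0 0 =
    (x^T *m Q *m x) 0 0 - ((expmx A *m x)^T *m Q *m (expmx A *m x)) 0 0.
  by rewrite /W mulmxBr mulmxBl trmx_mul !mulmxA mxE [X in _ + X]mxE.
have Ws : W \is symmetricmx.
  move: Qs; rewrite !symmetricmxE => /eqP Qs.
  by rewrite /W linearB/= 2!trmx_mul trmxK -Qs mulmxA.
have Wpos x : x != 0 -> 0 < (x^T *m W *m x) 0 0.
  by move=> x0; rewrite WE subr_gt0 (observable_decrease obs AQ).
have [d d1 Qd] := pos_form_dominates Q Ws Wpos.
have d0 : 0 < d by exact: lt_le_trans ltr01 d1.
pose q := 1 - d^-1.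
have q0 : 0 <= q by rewrite subr_ge0 invf_le1.
have q1 : q < 1 by rewrite gtrBl invr_gt0.
have VS x : ((expmx A *m x)^T *m Q *m (expmx A *m x)) 0 0 <=
    q * (x^T *m Q *m x) 0 0.
  have := Qd x; rewrite WE mulrC -ler_pdivrMr// => Qx.
  by rewrite /q mulrBl mul1r lerBrDr addrC -lerBrDr mulrC.
have VN N x : ((expmx (N%:R *: A) *m x)^T *m Q *m (expmx (N%:R *: A) *m x)) 0 0
    <= q ^+ N * (x^T *m Q *m x) 0 0.
  elim: N => [|N IH]; first by rewrite scale0r expmx0 mul1mx mul1r.
  have -> : expmx (N.+1%:R *: A) *m x = expmx A *m (expmx (N%:R *: A) *m x).
    by rewrite -nat1r expmxD scale1r mulmxA.
  rewrite exprS -mulrA.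
  by apply: le_trans (VS _) _; rewrite ler_wpM2l.
have [c c0 Qc] := pos_form_coercive Qs Qpos.
move=> x; apply: cvg_mx => i j; rewrite ord1 mxE.
apply/cvgrPdist_lt => e e0.
have qN : (c * (x^T *m Q *m x) 0 0) * q ^+ N @[N --> \oo] --> (0 : K).
  rewrite -[X in _ --> X](mulr0 (c * (x^T *m Q *m x) 0 0)).
  apply: cvgM; first exact: cvg_cst.
  by apply: cvg_expr; rewrite ger0_norm.
(* Coordinates are controlled through their squares, hence e^2. The bound at time N persists for t
   >= N because the form Q is nonincreasing along the flow. *)
have /cvgrPdist_lt/(_ _ (exprn_gt0 2 e0)) [N _ Ne] := qN.
exists N%:R; split; first exact: num_real.
move=> t /ltW Nt; rewrite sub0r normrN -(@ltr_pXn2r _ 2) ?nnegrE ?(ltW e0)//.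
rewrite real_normK ?num_real//.
apply: le_lt_trans (sqr_coord_le _ i) _.
apply: le_lt_trans (Qc _) _.
have QN := lyapunov_nincr x AQ (@gram_form_ge0 _ _ _ C) Nt.
apply: le_lt_trans (ler_wpM2l c0 QN) _.
apply: le_lt_trans (ler_wpM2l c0 (VN N x)) _.
have := Ne N (leqnn N); rewrite /= sub0r normrN ger0_norm; last first.
  by rewrite !mulr_ge0// exprn_ge0.
by rewrite mulrAC -mulrA.
Qed.

(** * Square-integrable trajectories and solvability of the Lyapunov equation *)

Definition square_integrable_flow A := forall x,
  (\int[lebesgue_measure]_(t in `[0%R, +oo[)
     ((enorm (expmx (t *: A) *m x) ^+ 2)%R%:E) < +oo)%E.

Lemma enorm_sqr (p : nat) (x : 'cV[K]_p) : enorm x ^+ 2 = (x^T *m x) 0 0.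
Proof.
rewrite sqr_sqrtr ?sumr_ge0// => [|i _]; last exact: sqr_ge0.
by rewrite mxE; apply: eq_bigr => i _; rewrite mxE expr2.
Qed.

(** The squared norm is the form of the identity matrix along the flow, hence differentiable,
    continuous and measurable. *)
Lemma measurable_enorm_flow A x :
  measurable_fun (`[0%R, +oo[ : set K)
    (fun t : K => (enorm (expmx (t *: A) *m x) ^+ 2)%:E).
Proof.
apply/measurable_EFinP; apply: measurable_funTS.
apply: continuous_measurable_fun => t.
apply/differentiable_continuous/derivable1_diffP.
have := @is_mxderive_form K n A 1%:M x x t 0 0.
rewrite (_ : (fun s => _) = fun s => enorm (expmx (s *: A) *m x) ^+ 2).
  by case.
by apply/funext => s; rewrite mulmx1 enorm_sqr.
Qed.

(** Otherwise the sum of the two squared norms stays at least e on a half-line of infinite measure,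
    and its integral is infinite. *)
Lemma square_integrable_flow_small A x y (e : K) : square_integrable_flow A ->
  0 < e -> exists2 t : K, 0 <= t &
    ((expmx (t *: A) *m x)^T *m (expmx (t *: A) *m x)) 0 0 +
    ((expmx (t *: A) *m y)^T *m (expmx (t *: A) *m y)) 0 0 < e.
Proof.
move=> intA e0; apply: contrapT => large.
have : (\int[lebesgue_measure]_(t in `[0%R, +oo[) (cst e%:E t) <=
  \int[lebesgue_measure]_(t in `[0%R, +oo[)
    ((enorm (expmx (t *: A) *m x) ^+ 2)%:E +
     (enorm (expmx (t *: A) *m y) ^+ 2)%:E))%E.
  apply: ge0_le_integral => //.
  - by move=> t _; rewrite lee_fin ltW.
  - by apply: emeasurable_funD; exact: measurable_enorm_flow.
  - move=> t; rewrite /= in_itv/= andbT => t0; rewrite -EFinD lee_fin leNgt.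
    by apply/negP => te; apply: large; exists t; rewrite -?enorm_sqr.
rewrite ge0_integralD//; last 4 first.
- by move=> t _; rewrite lee_fin sqr_ge0.
- exact: measurable_enorm_flow.
- by move=> t _; rewrite lee_fin sqr_ge0.
- exact: measurable_enorm_flow.
rewrite integral_cst//= lebesgue_measure_itv/= ltry.
rewrite addye// gt0_muley ?lte_fin// => /le_lt_trans.
by move=> /(_ _ (lte_add_pinfty (intA x) (intA y))); rewrite ltxx.
Qed.

(** The form x^T Q y is constant along the flow, yet bounded by M times the sum of squared norms,
    which gets arbitrarily small. Q need not be symmetric, as invertibility on all matrices is the
    goal. *)
Lemma lyapunov_injective A Q : square_integrable_flow A ->
  A^T *m Q + Q *m A = 0 -> Q = 0.
Proof.
move=> intA AQ; apply: mx_eq0_form => x y.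
pose V s := (expmx (s *: A) *m x)^T *m Q *m (expmx (s *: A) *m y).
have V0 s : is_mxderive V s 0.
  by have := is_mxderive_form A Q x y s; rewrite AQ mulmx0 mul0mx.
have Vcst s : V s = x^T *m Q *m y.
  by rewrite (is_mxderive0_cst V0 s 0) /V scale0r expmx0 !mul1mx.
have [M M0 QM] := form_bound Q.
apply/eqP; rewrite -normr_le0; apply/ler_addgt0Pl => e e0; rewrite addr0.
(* M may be 0, so the threshold is e / (M + 1). *)
have M1 : 0 < M + 1 by rewrite ltr_wpDl.
have [t _ te] := square_integrable_flow_small x y intA (divr_gt0 e0 M1).
rewrite -(Vcst t); apply: le_trans (QM _ _) _.
apply: le_trans (ler_wpM2l M0 (ltW te)) _.
by rewrite mulrCA ger_pMr// ler_pdivrMr// mul1r lerDl.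
Qed.

Lemma lyapunov_exists A R : square_integrable_flow A ->
  exists Q, lyapunov_eq A R Q.
Proof.
move=> intA.
(* The Lyapunov operator as a square matrix on vectorised matrices: a trivial kernel makes it
   invertible. *)
pose L := lin_mulmx A^T + lin_mulmxr A : 'M[K]_(n * n).
have LE Q : mxvec Q *m L = mxvec (A^T *m Q + Q *m A).
  by rewrite mulmxDr !mul_vec_lin linearD.
have Lu : L \in unitmx.
  rewrite -row_free_unit; apply: inj_row_free => v vL.
  rewrite -[v]vec_mxK (@lyapunov_injective A (vec_mx v) intA) ?linear0//.
  by apply: (can_inj mxvecK); rewrite -LE vec_mxK vL linear0.
exists (vec_mx (mxvec (- R) *m invmx L)); apply: (can_inj mxvecK).
by rewrite -LE vec_mxK mulmxKV.
Qed.

(** The value at time 0 is at least the value at any later time t, and for a suitable t the latter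
    is at least - e. *)
Lemma lyapunov_nonneg A R Q x : square_integrable_flow A ->
  lyapunov_eq A R Q -> (forall x, 0 <= (x^T *m R *m x) 0 0) ->
  0 <= (x^T *m Q *m x) 0 0.
Proof.
move=> intA AQ R0; have [M M0 QM] := form_bound Q.
apply/ler_addgt0Pl => e e0.
have M1 : 0 < M + 1 by rewrite ltr_wpDl.
have [t t0 te] := square_integrable_flow_small x x intA (divr_gt0 e0 M1).
have := lyapunov_nincr x AQ R0 t0; rewrite scale0r expmx0 mul1mx => Vt.
rewrite addrC -lerBlDr sub0r (le_trans _ Vt)//.
rewrite lerNl (le_trans (ler_norm _))// normrN (le_trans (QM _ _))//.
apply: le_trans (ler_wpM2l M0 (ltW te)) _.
by rewrite mulrCA ger_pMr// ler_pdivrMr// mul1r lerDl.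
Qed.

End Stability.

Theorem theorem5p2 (K : realType) (n m : nat) (n_ge1 : (1 <= n)%N)
    (m_ge1 : (1 <= m)%N) (A : 'M[K]_n) :
  (forall C : 'M[K]_(m, n),
     observable A C ->
     (exists Q : 'M[K]_n,
        nonneg_definite Q /\ lyapunov_eq A (C^T *m C) Q) ->
     stable A)
  /\
  ((forall x0 : 'cV[K]_n,
      (\int[lebesgue_measure]_(t in `[0%R, +oo[)
         ((enorm (expmx (t *: A) *m x0) ^+ 2)%R%:E) < +oo)%E) ->
   forall R : 'M[K]_n, R \is symmetricmx ->
     (exists! Q : 'M[K]_n, Q \is symmetricmx /\ lyapunov_eq A R Q) /\
     (forall Q : 'M[K]_n, Q \is symmetricmx -> lyapunov_eq A R Q ->
        (pos_definite R -> pos_definite Q) /\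
        (nonneg_definite R -> nonneg_definite Q))).
Proof.
split=> [C obs [Q [Qn AQ]]|intA R Rs]; first exact: observable_stable obs Qn AQ.
have uniq (Q Q' : 'M[K]_n) : lyapunov_eq A R Q -> lyapunov_eq A R Q' -> Q = Q'.
  rewrite /lyapunov_eq => AQ AQ'; apply/eqP; rewrite -subr_eq0; apply/eqP.
  apply: (lyapunov_injective intA).
  by rewrite mulmxBr mulmxBl addrACA AQ -opprD AQ' subrr.
split.
  have [Q AQ] := lyapunov_exists R intA; exists Q; split=> [|Q' [_ AQ']].
    (* Since R is symmetric, Q^T solves the same equation; uniqueness among all matrices gives Q =
       Q^T. *)
    split=> //; rewrite symmetricmxE; apply/eqP/uniq => //.
    move: Rs; rewrite symmetricmxE => /eqP Rs.
    have := congr1 trmx AQ; rewrite linearD linearN/= 2!trmx_mul trmxK -Rs.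
    by rewrite addrC.
  exact: uniq.
move=> Q Qs AQ; split=> [[_ R0]|[_ R0]]; last first.
  by split=> // x; exact: lyapunov_nonneg intA AQ R0.
have R_ge0 (x : 'cV_n) : 0 <= (x^T *m R *m x) 0 0.
  by have [->|/R0/ltW//] := eqVneq x 0; rewrite mulmx0 mxE.
have Q_ge0 (x : 'cV_n) : 0 <= (x^T *m Q *m x) 0 0.
  exact: lyapunov_nonneg intA AQ R_ge0.
split=> // x x0; rewrite lt_neqAle Q_ge0 andbT eq_sym.
(* If x^T Q x = 0 then Q x = 0, and the equation between x^T and x yields x^T R x = 0, against R >
   0. *)
apply: contraTneq (R0 x x0) => /(nonneg_form_eq0 Qs Q_ge0) Qx.
have QxT : x^T *m Q = 0.
  by move: Qs; rewrite symmetricmxE => /eqP ->; rewrite -trmx_mul Qx trmx0.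
rewrite -[R]opprK -AQ mulmxN mulNmx mulmxDr mulmxDl !mulmxA QxT !mul0mx.
by rewrite -!mulmxA Qx !mulmx0 addr0 oppr0 mxE ltxx.
Qed.
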